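(* Let $A$ be an $n\times n$ real SPD matrix, $b,x_0\in\mathbb{R}^n$ with $x_0\neq x:=A^{-1}b$, $\kappa_{\max}>1$ a real number, and $N\ge 1$ an integer (the number of iterations) with $N<n$. Then one can choose real SPD matrices $B_0,\dots,B_{N-1}$ with $\kappa(B_k^{-1}A)\le\kappa_{\max}$ for $k=0,\dots,N-1$ such that, for every sequence of integers $m_0,m_1,\dots$ with $0\le m_k\le k$ and $m_{k+1}\le m_k+1$, the method described in the context with $A,b,x_0,\{B_k\},\{m_k\}$ turns into the PSD method (i.e. for all $k=0,\dots,N-1$ one has $p_k=s_k$, and the iterates coincide with those of the same method with $m_k=0$ for all $k$), and on every iteration $k=0,\dots,N-1$ $$\frac{\|e_{k+1}\|_A}{\|e_k\|_A}=\frac{\kappa_{\max}-1}{\kappa_{\max}+1}.$$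
   Context: SPD means real symmetric positive definite. $(\cdot,\cdot)$ is the standard inner product, $(x,y)_A=(x,Ay)$ and $\|x\|_A=\sqrt{(x,x)_A}$. For SPD $A$ and $B$, the eigenvalues of $B^{-1}A$ are real positive and $\kappa(B^{-1}A)=\lambda_{\max}(B^{-1}A)/\lambda_{\min}(B^{-1}A)$. The method: given $A$, $b$, preconditioners $\{B_k\}$, integers $\{m_k\}$ and an initial guess $x_0$, for $k=0,1,\dots$ compute $r_k=b-Ax_k$, $s_k=B_k^{-1}r_k$, and $$p_k=s_k-\sum_{l=k-m_k}^{k-1}\frac{(As_k,p_l)}{(Ap_l,p_l)}p_l,\qquad x_{k+1}=x_k+\frac{(r_k,p_k)}{(Ap_k,p_k)}p_k .$$ The error is $e_k=x-x_k$, where $x=A^{-1}b$. The preconditioned steepest descent (PSD) method is the case $m_k=0$ for all $k$, in which $p_k=s_k$. *)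

(* Defs.v *)
From HB Require Import structures.
From mathcomp Require Import all_boot all_order all_algebra.
From mathcomp Require Import reals.

Set Implicit Arguments.
Unset Strict Implicit.
Unset Printing Implicit Defensive.

Import Order.TTheory GRing.Theory Num.Theory.
Local Open Scope ring_scope.

Definition dot (R : realType) (n : nat) (x y : 'cV[R]_n) : R :=
  (x^T *m y) 0 0.

Definition spd (R : realType) (n : nat) (A : 'M[R]_n) : Prop :=
  A^T = A /\ forall x : 'cV[R]_n, x != 0 -> 0 < dot x (A *m x).

Definition normA (R : realType) (n : nat) (A : 'M[R]_n) (x : 'cV[R]_n) : R :=
  Num.sqrt (dot x (A *m x)).

Definition is_lambda_max (R : realType) (n : nat) (M : 'M[R]_n) (l : R) : Prop :=
  eigenvalue M l /\ forall a : R, eigenvalue M a -> a <= l.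

Definition is_lambda_min (R : realType) (n : nat) (M : 'M[R]_n) (l : R) : Prop :=
  eigenvalue M l /\ forall a : R, eigenvalue M a -> l <= a.

(* The condition number as a relation: for a general square matrix the real
   spectrum may be empty, so there need not be extreme eigenvalues. *)
Definition is_kappa (R : realType) (n : nat) (M : 'M[R]_n) (kappa : R) : Prop :=
  exists lmax lmin : R,
    [/\ is_lambda_max M lmax, is_lambda_min M lmin & kappa = lmax / lmin].

Definition residual (R : realType) (n : nat) (A : 'M[R]_n) (b x : 'cV[R]_n) :
    'cV[R]_n :=
  b - A *m x.

(* [new_direction] is p_k, computed from s = s_k and from the list
   ps = [:: p_0; ...; p_(k-1)] of the previous directions; m stands for m_k. *)
Definition new_direction (R : realType) (n : nat) (A : 'M[R]_n) (m k : nat)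
    (s : 'cV[R]_n) (ps : seq 'cV[R]_n) : 'cV[R]_n :=
  s - \sum_(k - m <= l < k)
        (dot (A *m s) ps`_l / dot (A *m ps`_l) ps`_l) *: ps`_l.

(* The pair (x_k, [:: p_0; ...; p_(k-1)]). *)
Fixpoint state (R : realType) (n : nat) (A : 'M[R]_n) (b x0 : 'cV[R]_n)
    (B : nat -> 'M[R]_n) (m : nat -> nat) (k : nat) :
    'cV[R]_n * seq 'cV[R]_n :=
  if k is k'.+1 then
    let: (x, ps) := state A b x0 B m k' in
    let r := residual A b x in
    let s := invmx (B k') *m r in
    let p := new_direction A (m k') k' s ps in
    (x + (dot r p / dot (A *m p) p) *: p, rcons ps p)
  else (x0, [::]).

Definition iterate (R : realType) (n : nat) (A : 'M[R]_n) (b x0 : 'cV[R]_n)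
    (B : nat -> 'M[R]_n) (m : nat -> nat) (k : nat) : 'cV[R]_n :=
  (state A b x0 B m k).1.

Definition res (R : realType) (n : nat) (A : 'M[R]_n) (b x0 : 'cV[R]_n)
    (B : nat -> 'M[R]_n) (m : nat -> nat) (k : nat) : 'cV[R]_n :=
  residual A b (iterate A b x0 B m k).

Definition prec_res (R : realType) (n : nat) (A : 'M[R]_n) (b x0 : 'cV[R]_n)
    (B : nat -> 'M[R]_n) (m : nat -> nat) (k : nat) : 'cV[R]_n :=
  invmx (B k) *m res A b x0 B m k.

Definition direction (R : realType) (n : nat) (A : 'M[R]_n) (b x0 : 'cV[R]_n)
    (B : nat -> 'M[R]_n) (m : nat -> nat) (k : nat) : 'cV[R]_n :=
  new_direction A (m k) k (prec_res A b x0 B m k) (state A b x0 B m k).2.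

Definition error (R : realType) (n : nat) (A : 'M[R]_n) (b x0 : 'cV[R]_n)
    (B : nat -> 'M[R]_n) (m : nat -> nat) (k : nat) : 'cV[R]_n :=
  invmx A *m b - iterate A b x0 B m k.

Lemma state_directions (R : realType) (n : nat) (A : 'M[R]_n)
    (b x0 : 'cV[R]_n) (B : nat -> 'M[R]_n) (m : nat -> nat) (k : nat) :
  (state A b x0 B m k).2 = mkseq (direction A b x0 B m) k.
Proof.
elim: k => [//|k IHk]; rewrite mkseqS -IHk /direction /prec_res /res /iterate /=.
by case: (state A b x0 B m k).
Qed.

Lemma iterate0 (R : realType) (n : nat) (A : 'M[R]_n) (b x0 : 'cV[R]_n)
    (B : nat -> 'M[R]_n) (m : nat -> nat) :
  iterate A b x0 B m 0 = x0.
Proof. by []. Qed.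

Lemma iterateS (R : realType) (n : nat) (A : 'M[R]_n) (b x0 : 'cV[R]_n)
    (B : nat -> 'M[R]_n) (m : nat -> nat) (k : nat) :
  let x := iterate A b x0 B m in
  let r := res A b x0 B m in
  let p := direction A b x0 B m in
  x k.+1 = x k + (dot (r k) (p k) / dot (A *m p k) (p k)) *: p k.
Proof.
rewrite /= /direction /prec_res /res /iterate /=.
by case: (state A b x0 B m k).
Qed.

Lemma directionE (R : realType) (n : nat) (A : 'M[R]_n) (b x0 : 'cV[R]_n)
    (B : nat -> 'M[R]_n) (m : nat -> nat) (k : nat) :
  let s := prec_res A b x0 B m in
  let p := direction A b x0 B m in
  p k = s k - \sum_(k - m k <= l < k)
                 (dot (A *m s k) (p l) / dot (A *m p l) (p l)) *: p l.
Proof.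
rewrite /= {1}/direction /new_direction state_directions; congr (_ - _).
by apply: eq_big_nat => l /andP[_ ltlk]; rewrite nth_mkseq.
Qed.

(* Main.v *)
Require Import Defs.
From HB Require Import structures.
From mathcomp Require Import all_boot all_order all_algebra.
From mathcomp Require Import reals.
From mathcomp Require Import ring lra.

Set Implicit Arguments.
Unset Strict Implicit.
Unset Printing Implicit Defensive.

Import Order.TTheory GRing.Theory Num.Theory.
Local Open Scope ring_scope.

(** Write [c = (kappa_max - 1) / (kappa_max + 1)] and work in the inner product
    of [A].  The idea is to prescribe the errors [e_k] first and to build the
    preconditioners from them.

    The errors are chosen with [(e_k, e_l)_A = c^(2l) |e_0|_A^2] for [k <= l]
    ([exists_error_sequence]).  Then [|e_{k+1}|_A = c |e_k|_A], and the steps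
    [e_k - e_{k+1}] are pairwise [A]-orthogonal, because [(e_k, e_l)_A] does not
    depend on [k] as long as [k <= l].  Each of them is also [A]-orthogonal
    to the error [e_{k+1}] that remains after it, so an exact line search from
    [e_k] along this step has step length one and ends in [e_{k+1}].

    It remains to find [B_k] with [B_k^-1 A e_k = e_k - e_{k+1}].  The vector
    [f = - e_{k+1} / c] has the same length as [e_k], so the [A]-orthogonal
    reflection [H] along [w = e_k - f] exchanges them, and [T = 1 + c H] maps
    [e_k] to [e_k + c f = e_k - e_{k+1}] ([precond_step]).  Since [H^2 = 1], the
    spectrum of [T] is [{1 - c, 1 + c}], whose ratio is exactly [kappa_max]
    ([is_kappa_precond]), and [B_k = A T^-1] is symmetric positive definite
    ([spd_precond]).

    With these preconditioners, every Gram-Schmidt coefficient in [p_k] is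
    an inner product of two different steps and vanishes.  Hence [p_k = s_k]
    whatever the truncation parameters are, and by induction the method runs
    through the prescribed errors. *)

(** * The energy inner product *)

Definition energy (R : realType) (n : nat) (A : 'M[R]_n) (x y : 'cV[R]_n) : R :=
  dot x (A *m y).

Section Energy.
Variables (R : realType) (n : nat) (A : 'M[R]_n).
Implicit Types x y z : 'cV[R]_n.

Lemma energyDl x y z : energy A (x + y) z = energy A x z + energy A y z.
Proof. by rewrite /energy /dot linearD mulmxDl mxE. Qed.

Lemma energyDr x y z : energy A x (y + z) = energy A x y + energy A x z.
Proof. by rewrite /energy /dot !mulmxDr mxE. Qed.

Lemma energyZl a x y : energy A (a *: x) y = a * energy A x y.
Proof. by rewrite /energy /dot linearZ -scalemxAl mxE. Qed.

Lemma energyZr a x y : energy A x (a *: y) = a * energy A x y.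
Proof. by rewrite /energy /dot -!scalemxAr mxE. Qed.

Lemma energy0l x : energy A 0 x = 0.
Proof. by rewrite -(scale0r 0) energyZl mul0r. Qed.

Lemma energyBl x y z : energy A (x - y) z = energy A x z - energy A y z.
Proof. by rewrite -scaleN1r energyDl energyZl mulN1r. Qed.

Lemma energyBr x y z : energy A x (y - z) = energy A x y - energy A x z.
Proof. by rewrite -scaleN1r energyDr energyZr mulN1r. Qed.

Lemma energy_mx x y : x^T *m A *m y = (energy A x y)%:M.
Proof. by rewrite -mulmxA [LHS]mx11_scalar. Qed.

(** There are fewer than [n] linear conditions on an [n]-vector, so the matrix
    of these conditions has a nontrivial kernel. *)
Lemma exists_energy_orthogonal k (v : 'I_k -> 'cV[R]_n) :
  (k < n)%N -> exists2 u, u != 0 & forall i, energy A (v i) u = 0.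
Proof.
move=> ltkn; pose M := \matrix_i ((v i)^T *m A).
have /rowV0Pn[r /sub_kermxP rM r0] : kermx M^T != 0.
  rewrite -mxrank_eq0 mxrank_ker mxrank_tr -lt0n subn_gt0.
  exact: leq_ltn_trans (rank_leq_row M) ltkn.
exists r^T => [|i]; first by rewrite -(inj_eq trmx_inj) trmxK trmx0.
have Mr : M *m r^T = 0 by rewrite -[M]trmxK -trmx_mul rM trmx0.
have /(congr1 (fun N : 'M_1 => N 0 0)) : (v i)^T *m A *m r^T = 0.
  by rewrite -[_ *m A](rowK (fun i => (v i)^T *m A)) -row_mul Mr row0.
by rewrite energy_mx !mxE eqxx mulr1n.
Qed.

Hypothesis hA : spd A.

Lemma energyC x y : energy A x y = energy A y x.
Proof.
case: hA => symA _; rewrite /energy /dot -[LHS](mxE trmx_key (fun i j => _ j i)).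
by rewrite -/(trmx _) !trmx_mul trmxK symA mulmxA.
Qed.

Lemma dot_mulmx_energy x y : dot (A *m x) y = energy A x y.
Proof. by case: hA => symA _; rewrite /energy /dot trmx_mul symA mulmxA. Qed.

Lemma energy_gt0 x : x != 0 -> 0 < energy A x x.
Proof. by case: hA => _; apply. Qed.

Lemma energy_ge0 x : 0 <= energy A x x.
Proof. by have [->|/energy_gt0/ltW//] := eqVneq x 0; rewrite energy0l. Qed.

Lemma spd_unitmx : A \in unitmx.
Proof.
rewrite -row_free_unit -kermx_eq0; apply: contraT => /rowV0Pn[r /sub_kermxP rA r0].
have r'0 : r^T != 0 by rewrite -(inj_eq trmx_inj) trmxK trmx0.
by have := energy_gt0 r'0; rewrite /energy /dot trmxK mulmxA rA mul0mx mxE ltxx.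
Qed.

End Energy.

(** * A geometric sequence of errors *)

Section Errors.
Variables (R : realType) (n : nat) (A : 'M[R]_n) (hA : spd A) (c : R).
Hypotheses (c_gt0 : 0 < c) (c_lt1 : c < 1).

(** Given [e_0, ..., e_N], pick [v] that is [A]-orthogonal to all of them and put
    [e_{N+1} = c^2 e_N + a v].  The inner products with the old errors are
    multiplied by [c^2], as required, and the length of the new error fixes [a].
    One fresh dimension is used per error, hence the bound on [N]. *)
Lemma exists_error_sequence (e0 : 'cV[R]_n) N : (N < n)%N ->
  exists2 e : nat -> 'cV[R]_n, e 0 = e0 &
    forall k l, (k <= l <= N)%N ->
      energy A (e k) (e l) = c ^+ (2 * l) * energy A e0 e0.
Proof.
elim: N => [|N IH] ltNn.
  by exists (fun=> e0) => // k [|l]; rewrite ?andbF // => _; rewrite mul1r.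
have [e e00 eE] := IH (ltnW ltNn).
have [v v0 ve] := exists_energy_orthogonal A (fun i : 'I_N.+1 => e i) ltNn.
set g := energy A e0 e0 in eE *; set vv := energy A v v.
have vv_gt0 : 0 < vv by apply: energy_gt0.
have g_ge0 : 0 <= g by apply: energy_ge0.
(* t = a^2 solves c^4 |e_N|_A^2 + t |v|_A^2 = c^2 |e_N|_A^2. *)
pose t := c ^+ 2 * (1 - c ^+ 2) * (c ^+ (2 * N) * g) / vv.
have t_ge0 : 0 <= t.
  rewrite /t !mulr_ge0 ?exprn_ge0 ?invr_ge0 ?(ltW c_gt0) ?(ltW vv_gt0) //.
  by rewrite subr_ge0 exprn_ile1 ?ltW.
pose f := c ^+ 2 *: e N + Num.sqrt t *: v.
exists (fun k => if (k <= N)%N then e k else f) => [//|k l /andP[lekl]].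
rewrite leq_eqVlt => /orP[/eqP lE|ltlN]; last first.
  have lelN : (l <= N)%N by [].
  by rewrite (leq_trans lekl lelN) lelN eE // lekl.
rewrite lE ltnn; rewrite lE in lekl.
have old j : (j <= N)%N -> energy A (e j) f = c ^+ (2 * N.+1) * g.
  move=> lejN; rewrite energyDr !energyZr eE ?lejN ?leqnn //.
  by rewrite (ve (Ordinal (lejN : j < N.+1)%N)) mulr0 addr0 mulnS exprD mulrA.
case: (leqP k N) => [/old //|_].
rewrite {1}/f energyDl !energyZl old // energyDr !energyZr.
rewrite (energyC hA v (e N)) (ve ord_max) mulr0 add0r [Num.sqrt t * _]mulrA.
rewrite -expr2 sqr_sqrtr //.
rewrite -/vv /t divfK ?gt_eqF // mulnS exprD; ring.
Qed.

End Errors.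

(** * Preconditioners with two eigenvalues *)

Section Preconditioner.
Variables (R : realType) (n : nat) (A : 'M[R]_n) (hA : spd A) (c : R).
Hypotheses (c_gt0 : 0 < c) (c_lt1 : c < 1).

Let addc_gt0 : 0 < 1 + c.
Proof. by rewrite addr_gt0. Qed.

Let subc2_gt0 : 0 < 1 - c ^+ 2.
Proof. by rewrite subr_gt0 exprn_ilt1 // ltW. Qed.

(** The [A]-orthogonal projector onto the line spanned by [w]. *)
Definition energy_proj (w : 'cV[R]_n) : 'M[R]_n :=
  (energy A w w)^-1 *: (w *m (w^T *m A)).

(** This is [A T^-1] for [T = (1 + c) - 2 c P = 1 + c (1 - 2 P)], with [P] the
    projector above: [T] acts as [1 - c] on the line of [w] and as [1 + c] on its
    [A]-orthogonal complement.  Writing the inverse of [T] as a combination of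
    [1] and [P] with positive coefficients makes positivity evident. *)
Definition precond (w : 'cV[R]_n) : 'M[R]_n :=
  A *m ((1 + c)^-1%:M + (2 * c / (1 - c ^+ 2)) *: energy_proj w).

Variable w : 'cV[R]_n.
Hypothesis w0 : w != 0.
Let P := energy_proj w.
Let ww0 : energy A w w != 0.
Proof. by rewrite gt_eqF // energy_gt0. Qed.

Lemma energy_proj_vec x : P *m x = (energy A w x / energy A w w) *: w.
Proof.
rewrite /P /energy_proj -scalemxAl -mulmxA energy_mx mul_mx_scalar scalerA.
by rewrite mulrC.
Qed.

Lemma energy_proj_idem : P *m P = P.
Proof.
rewrite {2 3}/P /energy_proj -scalemxAr [P *m (w *m _)]mulmxA energy_proj_vec divff //.
by rewrite scale1r.
Qed.

(** [eigenvalue] refers to row vectors; the row eigenvectors used below are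
    [x^T A] for column eigenvectors [x]. *)
Lemma vec_energy_proj x :
  x^T *m A *m P = (energy A x w / energy A w w) *: (w^T *m A).
Proof.
rewrite /P /energy_proj -scalemxAr [LHS](congr1 _ (mulmxA _ w _)).
rewrite energy_mx mul_scalar_mx scalerA.
by rewrite mulrC.
Qed.

Lemma spd_precond : spd (precond w).
Proof.
have c2 : 0 < 2 * c / (1 - c ^+ 2) by rewrite divr_gt0 // mulr_gt0.
have [symA posA] := hA; split=> [|x x0].
  rewrite /precond trmx_mul linearD /= tr_scalar_mx linearZ /= /energy_proj.
  rewrite linearZ /= !trmx_mul trmxK symA mulmxDl mulmxDr.
  by rewrite mul_scalar_mx mul_mx_scalar -!scalemxAl -!scalemxAr !mulmxA.
rewrite /precond -mulmxA -/(energy A _ _) mulmxDl mul_scalar_mx -scalemxAl.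
rewrite energy_proj_vec energyDr !energyZr (energyC hA w x).
rewrite ltr_pwDl ?mulr_gt0 ?invr_gt0 ?posA //.
rewrite mulr_ge0 ?(ltW c2) // mulrAC -expr2 divr_ge0 ?sqr_ge0 //.
exact/ltW/energy_gt0.
Qed.

Lemma precond_mul : invmx (precond w) *m A = (1 + c)%:M - (2 * c) *: P.
Proof.
have [c1 c2] : 1 + c != 0 /\ 1 - c ^+ 2 != 0 by rewrite !gt_eqF.
suff BT : precond w *m ((1 + c)%:M - (2 * c) *: P) = A.
  by rewrite -{1}BT mulKmx // spd_unitmx //; apply: spd_precond.
rewrite /precond -mulmxA -/P; move: P energy_proj_idem => Q QQ.
rewrite mulmxBr !mulmxDl -!scalar_mxM mulVf //.
rewrite mul_scalar_mx mul_mx_scalar -!scalemxAl -!scalemxAr QQ.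
rewrite !scalerA -addrA -scalerDl -scalerBl.
rewrite [X in X *: Q](_ : _ = 0); last by field; apply/andP.
by rewrite scale0r addr0 mulmx1.
Qed.

(** The eigenvalue [1 - c] belongs to [w] and [1 + c] to any vector that is
    [A]-orthogonal to [w], which exists in dimension at least two.  There are no
    others because [P] is idempotent. *)
Lemma is_kappa_precond : (1 < n)%N ->
  is_kappa (invmx (precond w) *m A) ((1 + c) / (1 - c)).
Proof.
move=> n_gt1; set T := _ *m A; have TE : T = _ := precond_mul.
have left_nz x : x != 0 -> x^T *m A != 0.
  apply: contra_neq => /(canRL (mulmxK (spd_unitmx hA))).
  by rewrite mul0mx => /(congr1 trmx); rewrite trmxK trmx0.
have eig x a : x != 0 -> (energy A x w / energy A w w) *: w = a *: x ->
    eigenvalue T (1 + c - 2 * c * a).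
  move=> x0 xE; apply/eigenvalueP; exists (x^T *m A); last exact: left_nz.
  rewrite TE mulmxBr mul_mx_scalar -scalemxAr vec_energy_proj.
  have -> : (energy A x w / energy A w w) *: (w^T *m A) = a *: (x^T *m A).
    by rewrite !scalemxAl -linearZ /= xE linearZ.
  by rewrite scalerA -scalerBl.
have eig_max : eigenvalue T (1 + c).
  have [u u0 /(_ 0) wu] := exists_energy_orthogonal A (fun _ : 'I_1 => w) n_gt1.
  rewrite -[1 + c]subr0 -(mulr0 (2 * c)); apply: (eig u) => //.
  by rewrite energyC // wu mul0r !scale0r.
have eig_min : eigenvalue T (1 - c).
  rewrite (_ : 1 - c = 1 + c - 2 * c * 1); last by ring.
  by apply: (eig w); rewrite // divff.
have eig_only a : eigenvalue T a -> 1 - c <= a <= 1 + c.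
  case/eigenvalueP=> v; rewrite TE mulmxBr mul_mx_scalar -scalemxAr => vT v0.
  have vP : (2 * c) *: (v *m P) = (1 + c - a) *: v.
    by rewrite scalerBl -vT opprB addrC subrK.
  have : (2 * c * (1 + c - a)) *: v = (1 + c - a) ^+ 2 *: v.
    move: P energy_proj_idem vP {vT} => Q QQ vQ.
    rewrite -scalerA -vQ -{1}QQ mulmxA.
    rewrite [(2 * c) *: (_ *m Q)]scalemxAl vQ -scalemxAl scalerA.
    by rewrite [_ * (1 + c - a)]mulrC -scalerA vQ scalerA -expr2.
  move/eqP; rewrite -subr_eq0 -scalerBl scaler_eq0 (negPf v0) orbF.
  rewrite expr2 -mulrBl mulf_eq0 => /orP[] /eqP; have := c_gt0; lra.
by exists (1 + c), (1 - c); split=> //; split=> // a /eig_only /andP[].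
Qed.

End Preconditioner.

(** The hypotheses give [(w, e)_A = (w, w)_A / 2] for [w = e + f / c], so the
    projection of [e] is [w / 2] and [T e = (1 + c) e - c w = e - f]. *)
Lemma precond_step (R : realType) (n : nat) (A : 'M[R]_n) (c : R)
    (e f : 'cV[R]_n) :
  spd A -> 0 < c -> c < 1 -> e != 0 ->
  energy A e f = c ^+ 2 * energy A e e -> energy A f f = c ^+ 2 * energy A e e ->
  e + c^-1 *: f != 0 /\
  invmx (precond A c (e + c^-1 *: f)) *m (A *m e) = e - f.
Proof.
move=> hA c0 c1 e0 ef ff; set w := e + _; set g := energy A e e in ef ff.
have g0 : 0 < g by apply: energy_gt0.
have cN0 : c != 0 by rewrite gt_eqF.
have we : energy A w e = (1 + c) * g.
  by rewrite energyDl energyZl (energyC hA f) ef -/g; field.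
have ww : energy A w w = 2 * (1 + c) * g.
  by rewrite energyDr energyZr we energyDl energyZl ef ff; field.
have w0 : w != 0.
  apply: contraTneq g0 => w0; move: we; rewrite w0 energy0l.
  move/esym/eqP; rewrite mulf_eq0 => /orP[/eqP|/eqP->]; last by rewrite ltxx.
  lra.
split=> //; rewrite mulmxA precond_mul // mulmxBl mul_scalar_mx -scalemxAl.
rewrite energy_proj_vec we ww scalerA.
rewrite (_ : 2 * c * _ = c); last by field; rewrite !gt_eqF //; lra.
by rewrite scalerDr scalerA divff // scale1r [1 + c]addrC scalerDl scale1r opprD
  addrACA subrr add0r.
Qed.

Theorem theorem5p1 (R : realType) (n : nat) (A : 'M[R]_n) (b x0 : 'cV[R]_n)
    (kappa_max : R) (N : nat)
    (hA : spd A) (hx0 : x0 != invmx A *m b) (hkappa : 1 < kappa_max)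
    (hN : (1 <= N)%N) (hNn : (N < n)%N) :
  exists B : nat -> 'M[R]_n,
    (forall k : nat, (k < N)%N ->
       spd (B k) /\
       exists2 kappa : R,
         is_kappa (invmx (B k) *m A) kappa & kappa <= kappa_max) /\
    (forall m : nat -> nat,
       (forall k : nat, (m k <= k)%N) ->
       (forall k : nat, (m k.+1 <= m k + 1)%N) ->
       [/\ forall k : nat, (k < N)%N ->
             direction A b x0 B m k = prec_res A b x0 B m k,
           forall k : nat, (k <= N)%N ->
             iterate A b x0 B m k = iterate A b x0 B (fun=> 0%N) k
         & forall k : nat, (k < N)%N ->
             normA A (error A b x0 B m k.+1) / normA A (error A b x0 B m k) =
             (kappa_max - 1) / (kappa_max + 1)]).
Proof.
set c := (kappa_max - 1) / (kappa_max + 1).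
have kN0 : kappa_max + 1 != 0 by rewrite gt_eqF //; lra.
have c_gt0 : 0 < c by rewrite divr_gt0 //; lra.
have c_lt1 : c < 1 by rewrite ltr_pdivrMr; lra.
have kappaE : (1 + c) / (1 - c) = kappa_max.
  rewrite /c; field; rewrite kN0 /=; apply/eqP; lra.
set x := invmx A *m b; pose e0 := x - x0.
have e0N0 : e0 != 0 by rewrite subr_eq0 eq_sym.
have [e eE0 eE] := exists_error_sequence hA c_gt0 c_lt1 e0 hNn.
set g := energy A e0 e0 in eE; have g_gt0 : 0 < g by apply: energy_gt0.
have ee_gt0 k : (k <= N)%N -> 0 < energy A (e k) (e k).
  by move=> lekN; rewrite eE ?leqnn // mulr_gt0 // exprn_gt0.
have eN0 k : (k <= N)%N -> e k != 0.
  move/ee_gt0; apply: contraTneq => ->.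
  by rewrite energy0l ltxx.
have step k : (k < N)%N ->
    energy A (e k) (e k.+1) = c ^+ 2 * energy A (e k) (e k) /\
    energy A (e k.+1) (e k.+1) = c ^+ 2 * energy A (e k) (e k).
  move=> ltkN; rewrite !eE ?leqnn ?leqnSn // ?(ltnW ltkN) //.
  by rewrite mulnS exprD mulrA.
pose B k := precond A c (e k + c^-1 *: e k.+1).
have BP k : (k < N)%N -> e k + c^-1 *: e k.+1 != 0 /\
    invmx (B k) *m (A *m e k) = e k - e k.+1.
  move=> ltkN; have [ef ff] := step k ltkN.
  by apply: precond_step => //; apply/eN0/ltnW.
(* Both energies (e_l, .) and (e_{l+1}, .) agree on e_k and e_{k+1}. *)
have orth k l : (l < k < N)%N -> energy A (e k - e k.+1) (e l - e l.+1) = 0.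
  case/andP=> ltlk ltkN; have lekN := ltnW ltkN.
  rewrite (energyC hA) energyBr !energyBl.
  by rewrite !eE ?subrr // ?ltkN ?lekN ?andbT ?(leqW ltlk) // ltnW // ltnW.
have run m k : (k <= N)%N -> iterate A b x0 B m k = x - e k /\
    forall l, (l < k)%N -> prec_res A b x0 B m l = e l - e l.+1 /\
      direction A b x0 B m l = e l - e l.+1.
  elim: k => [_|k IHk ltkN].
    by split=> //; rewrite iterate0 eE0 /e0 opprB addrCA subrr addr0.
  have [xk dirs] := IHk (ltnW ltkN).
  have rk : res A b x0 B m k = A *m e k.
    rewrite /res /residual xk mulmxBr /x mulKVmx ?spd_unitmx //.
    by rewrite opprB addrCA subrr addr0.
  have sk : prec_res A b x0 B m k = e k - e k.+1.
    by rewrite /prec_res rk; have [] := BP k ltkN.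
  have pk : direction A b x0 B m k = e k - e k.+1.
    rewrite directionE sk big_nat big1 ?subr0 // => l /andP[_ ltlk].
    have [_ ->] := dirs l ltlk.
    by rewrite !dot_mulmx_energy // orth ?ltlk // mul0r scale0r.
  split=> [|l]; last first.
    by rewrite ltnS leq_eqVlt => /orP[/eqP->//|/dirs].
  rewrite iterateS xk rk pk !dot_mulmx_energy //.
  have [ef ff] := step k ltkN.
  (* The step length is 1 since the step is A-orthogonal to the new error. *)
  have -> : energy A (e k - e k.+1) (e k - e k.+1) = energy A (e k) (e k - e k.+1).
    rewrite energyBl [X in _ - X]energyBr (energyC hA (e k.+1) (e k)).
    by rewrite ef ff subrr subr0.
  rewrite divff ?scale1r; last first.
    rewrite energyBr ef -{1}[energy A _ _]mul1r -mulrBl gt_eqF //.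
    by rewrite mulr_gt0 ?ee_gt0 ?(ltnW ltkN) // subr_gt0 exprn_ilt1 // ltW.
  by rewrite addrA subrK.
exists B; split=> [k ltkN|m _ _].
  have [w0 _] := BP k ltkN; split; first exact: spd_precond.
  exists kappa_max => //; rewrite -kappaE; apply: is_kappa_precond => //.
  exact: leq_ltn_trans hN hNn.
split=> k hk.
- by have [_ /(_ k (ltnSn k))[-> ->]] := run m k.+1 hk.
- by rewrite (run m k hk).1 (run _ k hk).1.
have errE j : (j <= N)%N -> error A b x0 B m j = e j.
  by move=> lejN; rewrite /error (run m j lejN).1 opprB addrCA subrr addr0.
rewrite !errE ?(ltnW hk) // /normA -!/(energy A _ _) (step k hk).2.
rewrite sqrtrM ?exprn_ge0 ?(ltW c_gt0) // sqrtr_sqr gtr0_norm // mulfK //.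
by rewrite gt_eqF // sqrtr_gt0 ee_gt0 // ltnW.
Qed.
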